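(* There is an absolute constant $C>0$ such that for every positive integer $n$ divisible by $3$ and every integer $k\geq 3$ there exists a weight function $\tilde w: E_{k,n}\to\mathbb{R}_{\geq 0}$ such that (1) $\mathrm{LP}(\tilde w)\leq \frac{1}{6}\left(5+\frac{1}{k-1}\right) + C/n$, and (2) every $k$-way cut $P$ of $\Delta_{k,n}$ satisfies $\mathrm{cost}(P,\tilde w)\geq 1$.
   Context: For integers $k\ge 2$, $n \geq 1$: $\Delta_k=\{x\in[0,1]^k : \sum_i x_i = 1\}$, $e^i$ is the $i$-th standard basis vector, $\Delta_{k,n}$ is the set of points of $\Delta_k$ all of whose coordinates are multiples of $1/n$, and $E_{k,n}$ is the set of unordered pairs $\{x,y\}$ of points of $\Delta_{k,n}$ with $\|x-y\|_1 = 2/n$. For $w: E_{k,n}\to\mathbb{R}_{\ge 0}$, $\mathrm{LP}(w) = \frac1n\sum_{\{x,y\}\in E_{k,n}} w(x,y)$ (the value of the CKR relaxation at the solution assigning each point to itself). A $k$-way cut of $\Delta_{k,n}$ is a map $P:\Delta_{k,n}\to[k]$ with $P(e^i)=i$ for all $i\in[k]$, and $\mathrm{cost}(P,w)=\sum_{\{x,y\}\in E_{k,n}} w(x,y)\,\mathbf{1}[P(x)\neq P(y)]$. *)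

(* Defs.v *)
From HB Require Import structures.
From mathcomp Require Import all_boot all_order all_algebra.
From mathcomp Require Import classical_sets reals.

Set Implicit Arguments.
Unset Strict Implicit.
Unset Printing Implicit Defensive.

Import Order.TTheory GRing.Theory Num.Theory.
Local Open Scope ring_scope.

Definition simplex (R : realType) (k : nat) : set 'rV[R]_k :=
  [set v | (forall i, 0 <= v 0 i <= 1) /\ \sum_i v 0 i = 1]%classic.

Definition simplex_grid (R : realType) (k n : nat) : set 'rV[R]_k :=
  [set v | simplex v /\
           forall i, exists m : int, v 0 i = m%:~R / n%:R]%classic.

Definition l1norm (R : realType) (k : nat) (v : 'rV[R]_k) : R :=
  \sum_i `|v 0 i|.

(* A finite type indexing [simplex_grid R k n]: the grid point is stored as its
   vector of numerators. The lemmas [gridpt_inj] and [simplex_gridE] below show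
   that [gridpt] is a bijection onto [simplex_grid R k n] when 0 < n. *)
Definition grid (k n : nat) : finType :=
  {x : {ffun 'I_k -> 'I_n.+1} | (\sum_i x i == n)%N}.

Definition gridpt (R : realType) (k n : nat) (x : grid k n) : 'rV[R]_k :=
  \row_i ((val x i : nat)%:R / n%:R).

Lemma vertex_subproof (k n : nat) (i : 'I_k) :
  (\sum_j [ffun j => if j == i then ord_max else ord0 : 'I_n.+1] j == n)%N.
Proof.
rewrite (bigD1 i) //= ffunE eqxx big1 ?addn0 // => j ji.
by rewrite ffunE (negbTE ji).
Qed.

Definition vertex (k n : nat) (i : 'I_k) : grid k n :=
  exist _ [ffun j => if j == i then ord_max else ord0] (vertex_subproof n i).

(* An unordered pair {x, y} is the set [set x; y]; x and y are automatically
   distinct when 0 < n. *)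
Definition edges (R : realType) (k n : nat) : {set {set grid k n}} :=
  [set [set p.1; p.2] | p : grid k n * grid k n
     & l1norm (gridpt R p.1 - gridpt R p.2) == 2 / n%:R].

(* Weights are total functions on sets of grid points; only their values on
   [edges R k n] matter. *)
Definition nonneg_weight (R : realType) (k n : nat) (w : {set grid k n} -> R) :=
  forall e, e \in edges R k n -> 0 <= w e.

Definition LP (R : realType) (k n : nat) (w : {set grid k n} -> R) : R :=
  n%:R^-1 * \sum_(e in edges R k n) w e.

Definition is_cut (k n : nat) (P : grid k n -> 'I_k) :=
  forall i, P (vertex n i) = i.

Definition separated (k n : nat) (P : grid k n -> 'I_k) (e : {set grid k n}) :=
  [exists x in e, exists y in e, P x != P y].

Definition cost (R : realType) (k n : nat) (P : grid k n -> 'I_k)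
    (w : {set grid k n} -> R) : R :=
  \sum_(e in edges R k n) w e * (separated P e)%:R.

Lemma gridpt_inj (R : realType) (k n : nat) :
  (0 < n)%N -> injective (@gridpt R k n).
Proof.
move=> n0 x y /rowP xy; apply: val_inj; apply/ffunP => i; apply: val_inj.
have := xy i; rewrite !mxE => /(mulIf _) H.
by apply/eqP; rewrite -(eqr_nat R) H // invr_eq0 pnatr_eq0 -lt0n.
Qed.

Lemma simplex_gridE (R : realType) (k n : nat) :
  (0 < n)%N -> @simplex_grid R k n = range (@gridpt R k n).
Proof.
move=> n0; have nR : 0 < n%:R :> R by rewrite ltr0n.
apply/seteqP; split=> v /=; last first.
  move=> [x _ <-]; split; first split.
  - move=> i; rewrite mxE divr_ge0 //= ler_pdivrMr // mul1r ler_nat.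
    by rewrite -ltnS ltn_ord.
  - under eq_bigr do rewrite mxE.
    by rewrite -mulr_suml -natr_sum (eqP (valP x)) divff // gt_eqF.
  - by move=> i; exists (Posz (val x i)); rewrite mxE.
move=> [[v01 v1] vn].
have vm i : exists m : 'I_n.+1, v 0 i == (m : nat)%:R / n%:R.
  have [z vz] := vn i; have /andP[] := v01 i; rewrite vz.
  rewrite pmulr_lge0 ?invr_gt0 // ler0z => z0.
  case: z z0 {vz} (vz) => // m _ vz; rewrite ler_pdivrMr // mul1r => mn.
  have {}mn : (m < n.+1)%N by rewrite ltnS -(ler_nat R).
  by exists (Ordinal mn); apply/eqP.
pose x := [ffun i => xchoose (vm i)].
have vx i : v 0 i = (x i : nat)%:R / n%:R.
  by rewrite ffunE; apply/eqP; exact: (xchooseP (vm i)).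
have sx : (\sum_i x i == n)%N.
  rewrite -(eqr_nat R) natr_sum; apply/eqP.
  have := congr1 ( *%R^~ n%:R) v1; rewrite mul1r mulr_suml => <-.
  by apply: eq_bigr => i _; rewrite vx divfK // gt_eqF.
exists (exist _ x sx) => //; apply/rowP => i.
by rewrite mxE vx.
Qed.

Lemma gridpt_vertex (R : realType) (k n : nat) (i : 'I_k) :
  (0 < n)%N -> gridpt R (vertex n i) = delta_mx 0 i.
Proof.
move=> n0; apply/rowP => j; rewrite !mxE ffunE eqxx /=.
by case: eqP => _ /=; rewrite ?mul0r // divff // pnatr_eq0 -lt0n.
Qed.

Lemma separated_pair (k n : nat) (P : grid k n -> 'I_k) (x y : grid k n) :
  separated P [set x; y] = (P x != P y).
Proof.
apply/idP/idP => [/exists_inP[a] | xy].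
  rewrite !inE => /orP[]/eqP-> /exists_inP[b]; rewrite !inE => /orP[]/eqP->;
    by rewrite ?eqxx // eq_sym.
by apply/exists_inP; exists x; rewrite ?set21 //; apply/exists_inP;
  exists y; rewrite ?set22.
Qed.

(* Main.v *)
Require Import Defs.
From mathcomp Require Import all_boot all_order all_algebra.
From mathcomp Require Import zify ring lra.
From mathcomp Require Import reals.
Import Order.TTheory GRing.Theory Num.Theory.

(* Write n = 3m. The weight is a multiple of a sum of lattice edges counted with
   multiplicity. On each triangular face, and for each of its two cyclic orders
   (i, j, l), cut the central hexagon {x : every numerator is at most 2m} into
   three m x m rhombi, the one attached to i being x_i >= m >= x_l; take the
   sides of the triangles of one orientation in it, together with two copies of
   a shortest path from the vertex i to each point of the segment x_i = 2m,
   0 < x_l <= m. For each ordered pair i, j add 2m copies of the side ij.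

   The key is a calibration adapted to each rhombus: a triangle labelled
   p1, p2, p3 has at least 2([p2 = i] - [p1 = i]) + 2([p2 = l] - [p3 = l])
   separated edges, where i, l are two distinct labels. Summed over a rhombus the
   right-hand side telescopes to its boundary. Between two adjacent rhombi of a
   face the boundary terms cancel, up to one term at the centre of the face; on
   the segment x_i = 2m the paths to it make up for the points not labelled i; on
   the side ij of the face the boundary terms count the points labelled l. The
   latter are paid for by the copies of the side, which is separated at least
   once more for each label other than i, j on it. *)

(** * Sums over concatenations and label changes along a path *)

Section BigSums.

Lemma sum_bigcat {I : finType} {T : Type} (P : pred I) (F : I -> seq T)
    (f : T -> nat) :
  \sum_(x <- \big[cat/[::]]_(i | P i) F i) f x
  = \sum_(i | P i) \sum_(x <- F i) f x.
Proof.
apply: (big_morph (fun s => \sum_(x <- s) f x)); last by rewrite big_nil.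
by move=> s t; rewrite big_cat.
Qed.

Lemma sum_ord_const (n c : nat) : \sum_(i < n) c = n * c.
Proof. by rewrite sum_nat_const card_ord. Qed.

Lemma telescope_ord (m : nat) (g : nat -> nat) :
  \sum_(s < m) g s + g m = g 0 + \sum_(s < m) g s.+1.
Proof. by rewrite -(big_ord_recr m (fun i => g i)) big_ord_recl. Qed.

Lemma change_along_path {T : eqType} (f : nat -> T) (n : nat) :
  (f n != f 0) <= \sum_(d < n) (f d != f d.+1).
Proof.
elim: n => [|n IH]; first by rewrite eqxx.
rewrite big_ord_recr /=; case: (eqVneq (f n) (f n.+1)) IH => [<-|_] /=; lia.
Qed.

(** A step brings at most one new label, and none unless the label changes. *)
Lemma labels_along_path {T : finType} (f : nat -> T) (n : nat) :
  \sum_(l : T) (l \in [seq f d | d <- iota 0 n.+1])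
  <= 1 + \sum_(d < n) (f d != f d.+1).
Proof.
elim: n => [|n IH].
  rewrite big_ord0 addn0 /= (bigD1 (f 0)) //= inE eqxx big1 // => l.
  by rewrite inE => /negbTE->.
rewrite big_ord_recr.
set s := [seq f d | d <- iota 0 n.+1] in IH.
have -> : [seq f d | d <- iota 0 n.+2] = rcons s (f n.+1).
  by rewrite -[n.+2]addn1 iotaD map_cat /= cats1 add0n.
have fns : f n \in s by rewrite map_f // mem_iota; lia.
rewrite addnA; apply: (leq_trans _ (leq_add IH (leqnn _))).
have [e|ne] := eqVneq (f n) (f n.+1).
  rewrite addn0; apply: leq_sum => l _.
  by rewrite mem_rcons inE -e; case: eqP => [->|]; rewrite ?fns.
have -> : nat_of_bool true = \sum_(l : T) (l == f n.+1).
  by rewrite (bigD1 (f n.+1)) //= eqxx big1 // => l /negbTE->.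
rewrite -big_split; apply: leq_sum => l _.
by rewrite mem_rcons inE; case: eqP; case: (l \in s).
Qed.

End BigSums.

(** * Ordered triples and pairs of distinct labels *)

Definition distinct3 {T : eqType} (i j l : T) : bool :=
  [&& i != j, j != l & l != i].

(** [distinct3] is invariant under cyclic rotation. This lets boundary terms of adjacent rhombi of a
    face be compared after summation. *)
Lemma sum_distinct3_rot {T : finType} (F : T -> T -> T -> nat) :
  \sum_i \sum_j \sum_(l | distinct3 i j l) F l i j
  = \sum_i \sum_j \sum_(l | distinct3 i j l) F i j l.
Proof.
under eq_bigr => i _.
  under eq_bigr do rewrite big_mkcond.
  rewrite exchange_big /=; over.
rewrite exchange_big /=; apply: eq_bigr => i _; apply: eq_bigr => j _.
rewrite [RHS]big_mkcond; apply: eq_bigr => l _.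
by rewrite /distinct3; case: (i != j); case: (j != l); case: (l != i).
Qed.

Lemma card_neq2 {T : finType} (i j : T) :
  i != j -> \sum_(l | distinct3 i j l) 1 = #|T| - 2.
Proof.
move=> ij; rewrite sum1_card -(cardsC [set i; j]) cards2 ij addnC addnK.
apply: eq_card => l; rewrite !inE unfold_in /= negb_or andbC.
by rewrite [j == l]eq_sym.
Qed.

Lemma card_ordered_pairs {T : finType} :
  \sum_(i : T) \sum_(j | i != j) 1 = #|T| * #|T|.-1.
Proof.
rewrite -sum_nat_const; apply: eq_bigr => i _.
rewrite sum1_card -(cardC1 i); apply: eq_card => j.
by rewrite !inE unfold_in /= eq_sym.
Qed.

Lemma sum_distinct3_const {T : finType} (c : nat) :
  \sum_(i : T) \sum_(j : T) \sum_(l | distinct3 i j l) c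
  = #|T| * #|T|.-1 * (#|T| - 2) * c.
Proof.
rewrite -card_ordered_pairs !big_distrl /=; apply: eq_bigr => i _.
rewrite !big_distrl /= [RHS]big_mkcond; apply: eq_bigr => j _.
rewrite -[c in LHS]mul1n -big_distrl /=.
have [ij|/negPn ij] := boolP (i != j); first by rewrite card_neq2 // mul1n.
by rewrite big_pred0 // => l; rewrite /distinct3 ij.
Qed.

(** * The calibration on one triangle and on one rhombus *)

Section Triangle.

Definition changes {T : eqType} (x y z : T) : nat :=
  (x != y) + (y != z) + (z != x).

(** At most one term on the left is nonzero, and a triangle with one separated edge has at least
    two. *)
Lemma changes_ge {T : eqType} (x z p1 p2 p3 : T) : x != z ->
  2 * (p2 == x) + 2 * (p2 == z)
  <= changes p1 p2 p3 + 2 * (p1 == x) + 2 * (p3 == z).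
Proof.
move=> xz; rewrite /changes.
have [->|p2x] := eqVneq p2 x; last have [->|p2z] := eqVneq p2 z; last by lia.
  rewrite (negbTE xz); have [->|p1x] := eqVneq p1 x; first by lia.
  by have [<-|] := eqVneq x p3; [rewrite eq_sym p1x|]; lia.
have [->|p3z] := eqVneq p3 z; first by lia.
have [->|p1z] := eqVneq p1 z; first by rewrite p3z; lia.
lia.
Qed.

(** Sum [changes_ge] over the triangles: the terms in [x] telescope in [s], those in [z] in [t],
    which leaves the four boundary segments. *)
Lemma rhombus_bound {T : eqType} (q : nat -> nat -> T) (x z : T) (m : nat) :
  x != z ->
  2 * (\sum_(t < m) (q (m + m) t.+1 == x))
  + 2 * (\sum_(s < m) (q (m + s.+1) m == z))
  <= \sum_(s < m) \sum_(t < m)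
       changes (q (m + s) t.+1) (q (m + s.+1) t.+1) (q (m + s.+1) t)
     + 2 * (\sum_(t < m) (q m t.+1 == x))
     + 2 * (\sum_(s < m) (q (m + s.+1) 0 == z)).
Proof.
move=> xz.
have Hx : \sum_(s < m) \sum_(t < m) (q (m + s) t.+1 == x)
    + \sum_(t < m) (q (m + m) t.+1 == x)
  = \sum_(t < m) (q m t.+1 == x)
    + \sum_(s < m) \sum_(t < m) (q (m + s.+1) t.+1 == x).
  rewrite [X in X + _ = _]exchange_big [X in _ = _ + X]exchange_big /=.
  rewrite -!big_split /=; apply: eq_bigr => t _.
  by rewrite (telescope_ord m (fun s => (q (m + s) t.+1 == x) : nat)) addn0.
have Hz : \sum_(s < m) \sum_(t < m) (q (m + s.+1) t == z)
    + \sum_(s < m) (q (m + s.+1) m == z)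
  = \sum_(s < m) (q (m + s.+1) 0 == z)
    + \sum_(s < m) \sum_(t < m) (q (m + s.+1) t.+1 == z).
  rewrite -!big_split /=; apply: eq_bigr => s _.
  exact: (telescope_ord m (fun t => (q (m + s.+1) t == z) : nat)).
have : \sum_(s < m) \sum_(t < m) (2 * (q (m + s.+1) t.+1 == x)
                                  + 2 * (q (m + s.+1) t.+1 == z))
  <= \sum_(s < m) \sum_(t < m)
       (changes (q (m + s) t.+1) (q (m + s.+1) t.+1) (q (m + s.+1) t)
        + 2 * (q (m + s) t.+1 == x) + 2 * (q (m + s.+1) t == z)).
  by apply: leq_sum => s _; apply: leq_sum => t _; exact: changes_ge.
have sum2 (A B C : 'I_m -> 'I_m -> nat) :
    \sum_(s < m) \sum_(t < m) (A s t + 2 * B s t + 2 * C s t)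
    = \sum_(s < m) \sum_(t < m) A s t
      + 2 * (\sum_(s < m) \sum_(t < m) B s t)
      + 2 * (\sum_(s < m) \sum_(t < m) C s t).
  rewrite !big_distrr -!big_split; apply: eq_bigr => s _.
  by rewrite !big_distrr -!big_split.
rewrite (sum2 (fun s t => changes _ _ _)).
have := sum2 (fun _ _ => 0) (fun s t => q (m + s.+1) t.+1 == x : nat)
  (fun s t => q (m + s.+1) t.+1 == z : nat).
under eq_bigr do under eq_bigr do rewrite add0n.
move=> ->; rewrite big1 => [|s _]; last by rewrite big1.
lia.
Qed.

End Triangle.

(** * Grid points on a face and the edges between them *)

Section Embedding.

Context {k n : nat}.
Implicit Types (i j l t : 'I_k) (a b c : nat).

(* The grid point with numerators a, b, c at i, j, l; the indices need not be
   distinct, coinciding ones add up. It is junk unless a + b + c = n. *)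
Definition facept i j l a b c : grid k n :=
  insubd (vertex n i)
    [ffun t => inord (a * (t == i) + b * (t == j) + c * (t == l))].

Lemma faceptE i j l a b c t : a + b + c = n ->
  val (facept i j l a b c) t = a * (t == i) + b * (t == j) + c * (t == l) :> nat.
Proof.
move=> abc; have lt u : a * (u == i) + b * (u == j) + c * (u == l) < n.+1.
  by case: (u == i); case: (u == j); case: (u == l); lia.
have delta i' : \sum_(u : 'I_k) (u == i') = 1.
  by rewrite (bigD1 i') //= eqxx big1 // => u /negbTE->.
rewrite /facept val_insubd ifT ?ffunE ?inordK //.
under eq_bigr do rewrite ffunE inordK //.
by rewrite !big_split -!big_distrr !delta /= !muln1 abc.
Qed.

Lemma grid_ext (x y : grid k n) :
  (forall t, val x t = val y t :> nat) -> x = y.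
Proof.
by move=> xy; apply: val_inj; apply/ffunP => t; apply: val_inj; exact: xy.
Qed.

Lemma facept_rot i j l a b c : a + b + c = n ->
  facept i j l a b c = facept j l i b c a.
Proof. by move=> abc; apply: grid_ext => t; rewrite !faceptE; lia. Qed.

Lemma facept_side i j l l' a b : a + b = n ->
  facept i j l a b 0 = facept i j l' a b 0.
Proof. by move=> ab; apply: grid_ext => t; rewrite !faceptE; lia. Qed.

Lemma facept_vertex i j l : facept i j l n 0 0 = vertex n i.
Proof.
apply: grid_ext => t; rewrite faceptE ?addn0 // ffunE.
by case: (t == i); rewrite ?muln1 ?muln0.
Qed.

Lemma facept_edge (R : realType) i j l a b c :
  i != j -> a + b + c + 1 = n ->
  [set facept i j l a.+1 b c; facept i j l a b.+1 c] \in edges R k n.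
Proof.
move=> ij abc; apply/imsetP.
exists (facept i j l a.+1 b c, facept i j l a b.+1 c) => //.
rewrite inE /l1norm /=; apply/eqP.
have n0 : (0 < n%:R :> R)%R by rewrite ltr0n; lia.
transitivity (\sum_t ((t == i)%:R + (t == j)%:R) / n%:R : R)%R.
  apply: eq_bigr => t _; rewrite !mxE !faceptE; [|lia..].
  rewrite -mulrBl normrM [X in (_ * X)%R]ger0_norm ?invr_ge0 ?ltW //.
  rewrite !mulSn !natrD (_ : _ - _ = (t == i)%:R - (t == j)%:R)%R; last by ring.
  have [->|ti] := eqVneq t i; first by rewrite (negbTE ij) subr0 addr0 normr1.
  by case: (t == j); rewrite sub0r add0r normrN normr_nat.
have delta i' : (\sum_(u : 'I_k) (u == i')%:R = 1 :> R)%R.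
  by rewrite (bigD1 i') //= eqxx big1 ?addr0 // => u /negbTE->.
by rewrite -mulr_suml big_split /= !delta.
Qed.

End Embedding.

(** * The list of edges with multiplicity, for n = 3m *)

Section Instance.

Context {k m : nat}.
Implicit Types (i j l : 'I_k) (a c d : nat).

(** The coordinate at [j] is the remainder, so that the rhombus attached to [i] is the square m <= a
    <= 2m, 0 <= c <= m. *)
Definition face i j l a c : grid k (m * 3) := facept i j l a (m * 3 - a - c) c.

Definition side i j d : grid k (m * 3) := facept i j j d (m * 3 - d) 0.

Lemma face_side i j l d : d <= m * 3 -> face i j l d 0 = side i j d.
Proof. by move=> dm; rewrite /face /side subn0; apply: facept_side; lia. Qed.

Lemma face_rot i j l a b c : a + b + c = m * 3 ->
  face l i j a c = face i j l b a.
Proof.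
move=> abc; rewrite /face (_ : m * 3 - a - c = b); last by lia.
by rewrite facept_rot; [congr facept|]; lia.
Qed.

Lemma face_vertex i j l : face i j l (m * 3) 0 = vertex (m * 3) i.
Proof. by rewrite /face subnn sub0n facept_vertex. Qed.

Lemma side_start i j : side i j 0 = vertex (m * 3) j.
Proof.
by rewrite /side subn0 facept_rot ?add0n ?addn0 // facept_vertex.
Qed.

Lemma side_end i j : side i j (m * 3) = vertex (m * 3) i.
Proof. by rewrite /side subnn facept_vertex. Qed.

Definition rhombus_items i j l : seq (grid k (m * 3) * grid k (m * 3)) :=
  \big[cat/[::]]_(s < m) \big[cat/[::]]_(t < m)
    let: x := face i j l (m + s) t.+1 in
    let: y := face i j l (m + s.+1) t.+1 in
    let: z := face i j l (m + s.+1) t in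
    [:: (x, y); (y, z); (z, x)].

(* For each t, a shortest path from the vertex i to the point (2m, m-t-1, t+1). *)
Definition corner_items i j l : seq (grid k (m * 3) * grid k (m * 3)) :=
  \big[cat/[::]]_(t < m) \big[cat/[::]]_(d < m)
    [:: (face i j l (m * 3 - d) (minn d t.+1),
         face i j l (m * 3 - d.+1) (minn d.+1 t.+1))].

Definition side_items i j : seq (grid k (m * 3) * grid k (m * 3)) :=
  \big[cat/[::]]_(d < m * 3) [:: (side i j d, side i j d.+1)].

Definition items : seq (grid k (m * 3) * grid k (m * 3)) :=
  \big[cat/[::]]_i \big[cat/[::]]_j \big[cat/[::]]_(l | distinct3 i j l)
    (rhombus_items i j l ++ corner_items i j l ++ corner_items i j l)
  ++ \big[cat/[::]]_i \big[cat/[::]]_(j | i != j)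
       \big[cat/[::]]_(u < 2 * m) side_items i j.

(** Applied to the constant 1, to the indicator of a non-edge and to the indicator of a separated
    pair. *)
Lemma sum_items (f : grid k (m * 3) * grid k (m * 3) -> nat) :
  \sum_(p <- items) f p
  = \sum_i \sum_j \sum_(l | distinct3 i j l)
      (\sum_(p <- rhombus_items i j l) f p
       + 2 * \sum_(p <- corner_items i j l) f p)
    + 2 * m * \sum_i \sum_(j | i != j) \sum_(p <- side_items i j) f p.
Proof.
rewrite /items big_cat /= !sum_bigcat; congr (_ + _).
  apply: eq_bigr => i _; rewrite sum_bigcat; apply: eq_bigr => j _.
  rewrite sum_bigcat; apply: eq_bigr => l _.
  by rewrite !big_cat /= mul2n addnn.
rewrite big_distrr; apply: eq_bigr => i _.
rewrite sum_bigcat big_distrr; apply: eq_bigr => j _.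
by rewrite sum_bigcat sum_nat_const card_ord.
Qed.

(** A triple gives 3m^2 triangle sides and 2m^2 path steps; an ordered pair gives 2m copies of 3m
    steps. *)
Lemma size_items :
  size items = k * k.-1 * (k - 2) * (5 * m * m) + k * k.-1 * (6 * m * m).
Proof.
rewrite -sum1_size sum_items.
have Erh i j l : \sum_(p <- rhombus_items i j l) 1 = 3 * m * m.
  rewrite sum_bigcat.
  under eq_bigr do (rewrite sum_bigcat; under eq_bigr do rewrite sum1_size /=).
  by rewrite !sum_ord_const; lia.
have Eco i j l : \sum_(p <- corner_items i j l) 1 = m * m.
  rewrite sum_bigcat.
  under eq_bigr do (rewrite sum_bigcat; under eq_bigr do rewrite sum1_size /=).
  by rewrite !sum_ord_const muln1.
have Esi i j : \sum_(p <- side_items i j) 1 = m * 3.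
  rewrite sum_bigcat; under eq_bigr do rewrite sum1_size /=.
  by rewrite sum_ord_const muln1.
under eq_bigr do under eq_bigr do under eq_bigr do rewrite Erh Eco.
rewrite sum_distinct3_const card_ord; congr (_ + _).
  by congr (_ * _); lia.
under eq_bigr do (under eq_bigr do rewrite Esi -[_ * 3]mul1n; rewrite -big_distrl).
by rewrite -big_distrl /= card_ordered_pairs card_ord; lia.
Qed.

(** * Every listed pair is an edge of the grid *)

Section Edges.

Context {R : realType}.

Lemma face_edge_ij i j l a c : i != j -> a + c < m * 3 ->
  [set face i j l a.+1 c; face i j l a c] \in edges R k (m * 3).
Proof.
move=> ij ac; rewrite /face (_ : m * 3 - a - c = (m * 3 - a.+1 - c).+1).
  by apply: facept_edge => //; lia.
by lia.
Qed.

Lemma face_edge_jl i j l a c : j != l -> a + c < m * 3 ->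
  [set face i j l a c; face i j l a c.+1] \in edges R k (m * 3).
Proof.
move=> jl ac; rewrite /face (_ : m * 3 - a - c = (m * 3 - a - c.+1).+1).
  by rewrite 2?(@facept_rot _ _ i); [apply: facept_edge => //|..]; lia.
by lia.
Qed.

Lemma face_edge_li i j l a c : l != i -> a + c < m * 3 ->
  [set face i j l a c.+1; face i j l a.+1 c] \in edges R k (m * 3).
Proof.
move=> li ac; rewrite /face (_ : m * 3 - a.+1 - c = m * 3 - a - c.+1); last lia.
by rewrite -2?(@facept_rot _ _ l); [apply: facept_edge => //|..]; lia.
Qed.

Lemma items_edges (p : grid k (m * 3) * grid k (m * 3)) :
  p \in items -> [set p.1; p.2] \in edges R k (m * 3).
Proof.
(* Membership is turned into the vanishing of a sum, so that [sum_items] does the case analysis. *)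
pose f (p : grid k (m * 3) * grid k (m * 3)) : nat :=
  [set p.1; p.2] \notin edges R k (m * 3).
suff : \sum_(p <- items) f p == 0.
  rewrite sum_nat_seq_eq0 => /allP H /H /=.
  by rewrite /f; case: (_ \in edges _ _ _).
have f0 x y : [set x; y] \in edges R k (m * 3) -> f (x, y) = 0.
  by rewrite /f /= => ->.
rewrite sum_items (eq_bigr (fun=> 0)) => [|i _].
  rewrite big1 // add0n (eq_bigr (fun=> 0)) => [|i _]; first by rewrite big1 ?muln0.
  rewrite big1 // => j ij; rewrite sum_bigcat big1 // => d _; rewrite big_seq1.
  apply: f0; rewrite setUC /side (_ : m * 3 - d = (m * 3 - d.+1).+1).
    by apply: facept_edge => //; have := ltn_ord d; lia.
  by have := ltn_ord d; lia.
rewrite big1 // => j _; rewrite big1 // => l /and3P[ij jl li].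
rewrite sum_bigcat big1 => [|s _]; last first.
  rewrite sum_bigcat big1 // => t _; have := ltn_ord s; have := ltn_ord t => tm sm.
  rewrite !big_cons big_nil !f0 // addnS.
  - by rewrite setUC; apply: face_edge_li => //; lia.
  - by rewrite setUC; apply: face_edge_jl => //; lia.
  - by rewrite setUC; apply: face_edge_ij => //; lia.
rewrite sum_bigcat big1 // => t _; rewrite sum_bigcat big1 // => d _.
have := ltn_ord d; have := ltn_ord t => tm dm.
rewrite big_seq1; apply: f0; rewrite (_ : m * 3 - d = (m * 3 - d.+1).+1); last lia.
(* The path first moves units from [i] to [l], then from [i] to [j]. *)
have [dt|td] := leqP d t.
  rewrite (minn_idPl _) 1?(minn_idPl _) // ; last by lia.
  by rewrite setUC; apply: face_edge_li => //; lia.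
rewrite !(minn_idPr _); [|lia..].
by apply: face_edge_ij => //; lia.
Qed.

End Edges.

(** * Lower bound on the number of separated items *)

Section Cut.

Context (P : grid k (m * 3) -> 'I_k) (cutP : is_cut P).

Let separates (p : grid k (m * 3) * grid k (m * 3)) : nat := P p.1 != P p.2.

Let side_labels i j : seq 'I_k :=
  [seq P (side i j d) | d <- iota 0 (m * 3).+1].

(** Both [outer] and [inner] run along the segment x_i = m from the side [ij] to the centre.
    [outer], from the rhombus at [i], keeps the centre and omits the side point; [inner], from the
    rhombus at [j], does the opposite. *)
Let outer i j l : nat := \sum_(t < m) (P (face i j l m t.+1) == i).

Let inner i j l : nat := \sum_(t < m) (P (face i j l m t) == i).

Let centre i j l : nat := P (face i j l m m) == i.

(** Each path starts at the vertex [i], which the cut labels [i], so it is separated whenever its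
    end has another label. *)
Lemma corner_cut i j l :
  \sum_(t < m) (P (face i j l (m + m) t.+1) != i)
  <= \sum_(p <- corner_items i j l) separates p.
Proof.
rewrite sum_bigcat; apply: leq_sum => t _; rewrite sum_bigcat.
under eq_bigr do rewrite big_seq1 /separates /=.
have := change_along_path (fun d => P (face i j l (m * 3 - d) (minn d t.+1))) m.
rewrite subn0 min0n face_vertex cutP (minn_idPr _) //.
by rewrite (_ : m * 3 - m = m + m) //; lia.
Qed.

Lemma triple_cut i j l : distinct3 i j l ->
  2 * m + 2 * inner l i j
  <= \sum_(p <- rhombus_items i j l) separates p
     + 2 * \sum_(p <- corner_items i j l) separates p
     + 2 * outer i j l + 2 * m * (l \in side_labels i j).
Proof.
case/and3P => ij jl li.
have := @rhombus_bound _ (fun a c => P (face i j l a c)) i l m.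
rewrite eq_sym => /(_ li) rb.
have -> : \sum_(p <- rhombus_items i j l) separates p
    = \sum_(s < m) \sum_(t < m)
        changes (P (face i j l (m + s) t.+1)) (P (face i j l (m + s.+1) t.+1))
                (P (face i j l (m + s.+1) t)).
  rewrite sum_bigcat; apply: eq_bigr => s _; rewrite sum_bigcat.
  by apply: eq_bigr => t _; rewrite !big_cons big_nil /separates /= /changes; lia.
(* The segment x_l = m is shared with the rhombus at [l], which reads it in the opposite
   direction. *)
have -> : inner l i j = \sum_(s < m) (P (face i j l (m + s.+1) m) == l).
  rewrite /inner [LHS](reindex_inj rev_ord_inj); apply: eq_bigr => s _.
  by rewrite (face_rot _ _ _ _ (m + s.+1)) //=; have := ltn_ord s; lia.
have side_le : \sum_(s < m) (P (face i j l (m + s.+1) 0) == l)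
    <= m * (l \in side_labels i j).
  rewrite -sum_ord_const; apply: leq_sum => s _; have := ltn_ord s => sm.
  rewrite face_side; last by lia.
  case: eqP => // <-; rewrite map_f // mem_iota; lia.
(* Each of the m points with x_i = 2m is labelled [i] or paid for by its path. *)
have base : \sum_(t < m) (P (face i j l (m + m) t.+1) == i)
    + \sum_(t < m) (P (face i j l (m + m) t.+1) != i) = m.
  rewrite -big_split -[RHS]muln1 -sum_ord_const; apply: eq_bigr => t _ /=.
  by case: eqP.
have := corner_cut i j l; rewrite /outer; lia.
Qed.

Lemma outer_inner i j l : outer i j l <= inner i j l + centre i j l.
Proof.
have := telescope_ord m (fun t => (P (face i j l m t) == i) : nat).
by rewrite /outer /inner /centre; lia.
Qed.

(** The three rotations of a triple share the centre, whose single label equals at most one of [i],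
    [j], [l]. *)
Lemma sum_centre :
  3 * (\sum_i \sum_j \sum_(l | distinct3 i j l) centre i j l)
  <= k * k.-1 * (k - 2).
Proof.
have e1 := sum_distinct3_rot centre.
have e2 := sum_distinct3_rot (fun i j l => centre l i j).
have := sum_distinct3_const (T := 'I_k) 1; rewrite card_ord muln1 => <-.
rewrite mulSn mul2n -addnn -{2}e1 -{2}e1 -{2}e2 -!big_split; apply: leq_sum => i _.
rewrite -!big_split; apply: leq_sum => j _.
rewrite -!big_split; apply: leq_sum => l /and3P[ij jl li] /=.
rewrite /centre (face_rot l i j m m) ?(face_rot i j l m m); [|lia..].
have [->|] := eqVneq (P (face i j l m m)) i.
  by rewrite (negbTE ij) [i == l]eq_sym (negbTE li).
have [->|] := eqVneq (P (face i j l m m)) j; first by rewrite (negbTE jl).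
by case: (_ == l).
Qed.

(** The end labels [i] and [j] both occur, so every further label costs one more change. *)
Lemma side_cut i j : i != j ->
  1 + \sum_(l | distinct3 i j l) (l \in side_labels i j)
  <= \sum_(p <- side_items i j) separates p.
Proof.
move=> ij; have := labels_along_path (fun d => P (side i j d)) (m * 3).
rewrite -/(side_labels i j) sum_bigcat.
under [in X in _ -> _ <= X]eq_bigr do rewrite big_seq1 /separates /=.
have iL : i \in side_labels i j.
  apply/mapP; exists (m * 3); first by rewrite mem_iota; lia.
  by rewrite side_end cutP.
have jL : j \in side_labels i j.
  apply/mapP; exists 0; first by rewrite mem_iota; lia.
  by rewrite side_start cutP.
rewrite (bigD1 i) //= (bigD1 j) /=; last by rewrite eq_sym.
rewrite iL jL (eq_bigl (distinct3 i j)); last first.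
  by move=> l; rewrite /distinct3 ij /= [j == l]eq_sym andbC.
by move=> h; rewrite -(leq_add2l 1); exact: h.
Qed.

(** The factor 3 clears the denominator of the centre terms, of which at most a third are
    nonzero. *)
Lemma items_cut :
  k * k.-1 * ((k - 2) * (6 * m - 2) + 6 * m)
  <= 3 * \sum_(p <- items) separates p.
Proof.
pose S (F : 'I_k -> 'I_k -> 'I_k -> nat) : nat :=
  \sum_i \sum_j \sum_(l | distinct3 i j l) F i j l.
pose on_side i j l : nat := l \in side_labels i j.
pose C i j l := \sum_(p <- rhombus_items i j l) separates p
                + 2 * \sum_(p <- corner_items i j l) separates p.
pose L := \sum_i \sum_(j | i != j) \sum_(p <- side_items i j) separates p.
have S_le F G : (forall i j l, distinct3 i j l -> F i j l <= G i j l) -> S F <= S G.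
  by move=> FG; do 3![apply: leq_sum => ? ?]; exact: FG.
have SD F G : S (fun i j l => F i j l + G i j l) = S F + S G.
  by rewrite /S; do 2![rewrite -big_split; apply: eq_bigr => ? _]; rewrite -big_split.
have SM c F : S (fun i j l => c * F i j l) = c * S F.
  by rewrite /S; do 2![rewrite big_distrr; apply: eq_bigr => ? _]; rewrite big_distrr.
have Sc c : S (fun _ _ _ => c) = k * k.-1 * (k - 2) * c.
  by rewrite /S sum_distinct3_const card_ord.
have -> : \sum_(p <- items) separates p = S C + 2 * m * L by rewrite sum_items.
have triples : k * k.-1 * (k - 2) * (2 * m) + 2 * S inner
    <= S C + 2 * S outer + 2 * m * S on_side.
  have -> : S inner = S (fun i j l => inner l i j).
    exact: (esym (sum_distinct3_rot inner)).
  by rewrite -Sc -!SM -!SD; apply: S_le => i j l /triple_cut.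
have rim : S outer <= S inner + S centre.
  by rewrite -SD; apply: S_le => i j l _; exact: outer_inner.
have := sum_centre; rewrite -/(S centre) => mid.
have sides : k * k.-1 + S on_side <= L.
  have := card_ordered_pairs (T := 'I_k); rewrite card_ord => <-.
  rewrite -big_split; apply: leq_sum => i _ /=.
  rewrite [X in _ + X <= _](_ : _ =
      \sum_(j | i != j) \sum_(l | distinct3 i j l) on_side i j l); last first.
    rewrite [RHS]big_mkcond; apply: eq_bigr => j _.
    by case: ifPn => // ij; rewrite big_pred0 // => l; rewrite /distinct3 (negbTE ij).
  by rewrite -big_split; apply: leq_sum => j ij; exact: side_cut.
(* The goal is 3 [triples] + 6 [rim] + 2 [mid] + 6m [sides]. *)
have := leq_mul (leqnn m) sides; rewrite !mulnDr !mulnA mulnBr.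
move: mid triples rim; rewrite !mulnA; set N := k * k.-1; set M := N * (k - 2).
nia.
Qed.

End Cut.

End Instance.

(** * Normalising the weight and estimating its LP value *)

Local Open Scope ring_scope.

(** Double counting; it evaluates LP with [h] constant and the cost with [h] the separation
    indicator. *)
Lemma sum_edge_multiplicity {R : pzSemiRingType} {T : finType}
    (E : {set {set T}}) (s : seq (T * T)) (h : {set T} -> R) :
  (forall p, p \in s -> [set p.1; p.2] \in E) ->
  \sum_(e in E) (\sum_(p <- s) (e == [set p.1; p.2])%:R) * h e
  = \sum_(p <- s) h [set p.1; p.2].
Proof.
move=> sE; under eq_bigr do rewrite mulr_suml.
rewrite exchange_big /= big_seq [RHS]big_seq; apply: eq_bigr => p /sE pE.
rewrite (bigD1 _ pE) /= eqxx mul1r big1 ?addr0 // => e /andP[_ /negbTE->].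
by rewrite mul0r.
Qed.

(** With x = k - 2 and y = m, the left side is the LP value of the normalised weight; it tends to
    the first term on the right as y grows. *)
Lemma LP_value_bound {R : realFieldType} (x y : R) : 1 <= x -> 1 <= y ->
  (5 * x + 6) * y / (x * (6 * y - 2) + 6 * y)
  <= 1 / 6 * (5 + 1 / (x + 1)) + 2 / (y * 3).
Proof.
move=> x1 y1; have D0 : 0 < x * (6 * y - 2) + 6 * y by nra.
rewrite ler_pdivrMr // -subr_ge0.
rewrite (_ : _ - _ =
    (y * (7 * x ^+ 2 + 18 * x + 12) - 4 * x * (x + 1)) / (3 * y * (x + 1))).
  by rewrite divr_ge0 //; nra.
by field; apply/andP; split; apply: lt0r_neq0; lra.
Qed.

Theorem theorem8 (R : realType) :
  exists2 C : R, 0 < C &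
    forall n k : nat, (0 < n)%N -> (3 %| n)%N -> (3 <= k)%N ->
      exists w : {set grid k n} -> R,
        [/\ nonneg_weight w,
            LP w <= 1 / 6 * (5 + 1 / (k%:R - 1)) + C / n%:R
          & forall P : grid k n -> 'I_k, is_cut P -> 1 <= cost P w].
Proof.
(* The constant 2 matches the error term 2 / (3y) of [LP_value_bound], as n = 3m. *)
exists 2 => // n k n0 /dvdnP[m nE] k3; rewrite {}nE in n0 *.
(* By [items_cut] every cut separates at least Z / 3 items, so scaling by 3 / Z gives cost at least
   1. *)
pose Z : R := (k * k.-1 * ((k - 2) * (6 * m - 2) + 6 * m))%:R.
have Z0 : 0 < Z by rewrite ltr0n !muln_gt0 addn_gt0; lia.
pose mult (e : {set grid k (m * 3)}) : R :=
  \sum_(p <- items) (e == [set p.1; p.2])%:R.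
exists (fun e => 3 / Z * mult e); split.
- move=> e _; rewrite mulr_ge0 ?divr_ge0 ?(ltW Z0) //.
  exact: sumr_ge0.
- rewrite /LP -mulr_sumr.
  have := sum_edge_multiplicity _ _ (fun=> 1 : R) (@items_edges k m R).
  under eq_bigr do rewrite mulr1.
  move=> ->; rewrite big_const_seq count_predT iter_addr_0 size_items.
  have x1 : 1 <= (k - 2)%:R :> R by rewrite ler1n; lia.
  have y1 : 1 <= m%:R :> R by rewrite ler1n; lia.
  have := LP_value_bound _ _ x1 y1.
  have kR : k%:R = (k - 2)%:R + 2 :> R by rewrite -natrD subnK // ltnW.
  have N0 : 0 < (k * k.-1)%:R :> R by rewrite ltr0n muln_gt0; lia.
  have -> : k%:R - 1 = (k - 2)%:R + 1 :> R by rewrite kR; lra.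
  set x := (k - 2)%:R in x1 kR *; set y := m%:R in y1 *; set N := (k * k.-1)%:R in N0 *.
  have ZE : Z = N * (x * (6 * y - 2) + 6 * y).
    have m2 : (2 <= 6 * m)%N by lia.
    rewrite /Z natrM -/N natrD natrM (natrB _ m2).
    by rewrite !natrM -/x -/y.
  have sizeE : (k * k.-1 * (k - 2) * (5 * m * m) + k * k.-1 * (6 * m * m))%:R
      = N * y * (y * (5 * x + 6)) :> R.
    rewrite /N /x /y; move: (k * k.-1)%N (k - 2)%N => a b.
    by rewrite natrD !natrM; ring.
  rewrite sizeE ZE natrM -/y; apply: le_trans.
  have D0 : 0 < x * (6 * y - 2) + 6 * y by nra.
  rewrite le_eqVlt; apply/orP; left; apply/eqP.
  clearbody N x y; by field; rewrite !lt0r_neq0 //; lra.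
move=> P cutP; rewrite /cost.
have -> : \sum_(e in edges R k (m * 3)) 3 / Z * mult e * (separated P e)%:R
    = 3 / Z * \sum_(e in edges R k (m * 3)) mult e * (separated P e)%:R.
  by rewrite mulr_sumr; apply: eq_bigr => e _; rewrite mulrA.
rewrite sum_edge_multiplicity; last exact: items_edges.
under eq_bigr do rewrite separated_pair.
rewrite mulrAC ler_pdivlMr // mul1r -natr_sum -natrM ler_nat.
exact: items_cut.
Qed.
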